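(* Let $n\ge 3$ be an odd integer and let $C_n=\bigl(\csc(\tfrac{2jk\pi}{n})\bigr)_{j,k\in S_n}$. Then $$\det(C_n)=\varepsilon(n)\Bigl(\frac{n}{\pi}\Bigr)^{\frac{\phi(n)}{2}}\prod_{\chi\ \mathrm{odd}}\bigl(1-\chi(2)\bigr)L(1,\chi),$$ where the product is over all odd Dirichlet characters $\chi$ modulo $n$.
   Context: $\phi$ is Euler's function. $S_n=\{a\in\mathbb{Z} : 1\le a<n/2,\ \gcd(a,n)=1\}$. $L(s,\chi)=\sum_{m\ge1}\chi(m)m^{-s}$ is the Dirichlet $L$-function; $\chi$ is odd if $\chi(-1)=-1$. For odd $n\ge3$ with factorization $n=\prod_{i=1}^r p_i^{e_i}$ ($p_i$ distinct odd primes, $e_i\ge 1$), the sign $\varepsilon(n)$ is defined by: - $\varepsilon(n)=(-1)^{\phi(n)/2}$ if $r=1$ and ($p_1\equiv 1\pmod 8$ or $p_1\equiv 4e_1+3\pmod 8$); - $\varepsilon(n)=(-1)^{\phi(n)/2+1}$ if $r=1$ and $p_1\not\equiv 1\pmod 8$ and $p_1\not\equiv 4e_1+3\pmod 8$; - $\varepsilon(n)=(-1)^{\phi(n)/2+1}$ if $r=2$ and $p_1+p_2\equiv 0\pmod 4$; - $\varepsilon(n)=(-1)^{\phi(n)/2}$ otherwise. *)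

(* Defs.v *)
From mathcomp Require Import all_boot all_order all_algebra.
From mathcomp Require Import all_classical all_reals all_analysis.
From mathcomp Require Import complex.

Set Implicit Arguments.
Unset Strict Implicit.
Unset Printing Implicit Defensive.

Import Order.TTheory GRing.Theory Num.Theory.
Import numFieldNormedType.Exports.

Local Open Scope complex_scope.
Local Open Scope ring_scope.

Definition half_units (n : nat) : {set 'I_n} :=
  [set a : 'I_n | [&& (0 < a)%N, (2 * a < n)%N & coprime a n]]%SET.

Definition csc (R : realType) (x : R) : R := (sin x)^-1.

(* Rows and columns are listed by the same enumeration of half_units n,
   so the determinant does not depend on the enumeration. *)
Definition cscmx (R : realType) (n : nat) : 'M[R]_#|half_units n| :=
  \matrix_(s, t)
    let j : 'I_n := enum_val s in
    let k : 'I_n := enum_val t in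
    csc ((2 * j * k)%N%:R * pi / n%:R).

(* The case [:: p; q] lists the two prime divisors in increasing order; the
   condition on them is symmetric. *)
Definition sign_eps (n : nat) : int :=
  let h := (totient n)./2 in
  match primes n with
  | [:: p] =>
      if (p == 1 %[mod 8])%N || (p == 4 * logn p n + 3 %[mod 8])%N
      then (-1) ^+ h else (-1) ^+ h.+1
  | [:: p; q] => if (4 %| p + q)%N then (-1) ^+ h.+1 else (-1) ^+ h
  | _ => (-1) ^+ h
  end.

(* Dirichlet characters modulo n as functions on residue classes; 'Z_n is the
   ring of integers modulo n only for n > 1. An integer m is evaluated through
   its class m%:R. *)
Definition dirichlet_character (R : realType) (n : nat)
    (chi : {ffun 'Z_n -> R[i]}) : Prop :=
  [/\ chi 1 = 1,
      forall a b : 'Z_n, chi (a * b) = chi a * chi b &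
      forall a : 'Z_n, (chi a != 0) = (a \is a GRing.unit)].

Definition odd_characters (R : realType) (n : nat) :
    set {ffun 'Z_n -> R[i]} :=
  [set chi | dirichlet_character chi /\ chi (-1) = -1]%classic.
Arguments odd_characters : clear implicits.

Definition cexp (R : realType) (z : R[i]) : R[i] :=
  (expR (complex.Re z))%:C * (cos (complex.Im z) +i* sin (complex.Im z)).

(* m ^ z for a positive integer m, with the real logarithm of m. *)
Definition cpow (R : realType) (m : nat) (z : R[i]) : R[i] :=
  cexp (z * (ln m%:R)%:C).

(* The sum is the limit of the partial sums, since the series converges only
   conditionally at s = 1. The type ascription selects the topology of R[i] as
   a numFieldType. For a nontrivial character the series is L(s, chi) when
   0 < Re s; the analytic continuation is not covered. *)
Definition dirichlet_L (R : realType) (n : nat) (s : R[i]) (chi : {ffun 'Z_n -> R[i]}) :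
    R[i] :=
  limn (series (fun k : nat =>
    chi k.+1%:R * cpow k.+1 (- s) : (R[i] : numFieldType))).

(* Main.v *)
Require Import Defs.
From mathcomp Require Import all_boot all_order all_algebra.
From mathcomp Require Import all_classical all_reals all_analysis.
From mathcomp Require Import all_solvable all_field complex.
From mathcomp Require Import ring lra zify.

Set Implicit Arguments.
Unset Strict Implicit.
Unset Printing Implicit Defensive.

Import Order.TTheory GRing.Theory Num.Theory.
Import numFieldNormedType.Exports.

Local Open Scope complex_scope.
Local Open Scope ring_scope.

(** Let [G] be the group of units modulo [n] and [f x = csc (2 pi x / n)], an
    odd function on [G]. Since [half_units n] represents [G / {1, -1}],
    functions on it are the same as odd functions on [G], and the cosecant
    matrix is the operator sending [phi] to [k |-> \sum_j phi j * f (j k)]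
    on them. This operator is a convolution with [f] followed by the inversion
    [x |-> x^-1]. The odd characters form a basis of the space, and they
    diagonalize every convolution, with eigenvalue
    [2^-1 * \sum_(x in G) chi x * f x]; so the determinant is that of the
    inversion times the product of these numbers ([det_odd_mul]).

    The characters come from linear algebra. Translations by units are commuting
    operators of finite order, hence have a common basis of eigenvectors, and
    a common eigenvector of all translations is a multiple of a character
    ([odd_characters_basis], [odd_characters_complete]).

    The inversion is an involution, so its determinant is [(-1) ^ m] where [m]
    is the multiplicity of the eigenvalue [-1], which the trace determines.
    With [A] and [B] the numbers of square roots of [1] and of [-1] modulo [n],
    twice the trace is [A - B], whence [totient n + B = A + 4 m]
    ([det_inversion_mx]). By the Chinese remainder theorem [A] and [B] are
    products over the prime powers dividing [n], where [A] is [2], and [B] is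
    [2] or [0] as the prime is [1] or [3] modulo [4]. Reading off the parity of
    [m] gives the sign ([sign_epsE]).

    For the eigenvalues, [csc (2 y) = cot y - cot (2 y)] and multiplicativity
    reduce the sum to [1 - chi(2)^-1] times half of
    [\sum_(x in G) chi x * cot (pi x / n)], and the latter sum is
    [2 n / pi * L(1, chi)] by the partial fraction expansion of the cotangent
    ([dirichlet_L1], [odd_character_csc_sum]). Inverting characters permutes
    the odd ones, which turns [chi(2)^-1] into [chi(2)] in the product.

    The partial fraction expansion itself holds because its partial sums satisfy
    the same duplication formula as [pi * cot (pi x)]: the error after [2 ^ m]
    terms is the mean, over [2 ^ m] equally spaced points of the unit interval,
    of a Lipschitz function that is odd about [1/2], and such Riemann sums tend
    to [0] ([cot_remainder_pow2], [cvg_cot_partial]). *)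

(** * Partial fractions of the cotangent *)

Definition cot (R : realType) (x : R) : R := cos x / sin x.

Section Cotangent.
Context {R : realType}.
Implicit Types x y u v : R.

Lemma cotDpi x : cot (x + pi) = cot x.
Proof. by rewrite /cot sinDpi cosDpi invrN mulrNN. Qed.

Lemma cotN x : cot (- x) = - cot x.
Proof. by rewrite /cot sinN cosN invrN mulrN. Qed.

Lemma sin_mean_value x : 0 < x -> exists2 c, 0 < c < x & sin x = x * cos c.
Proof.
move=> x0.
have [|c cx] := @MVT R sin cos 0 x x0 (fun z _ => is_derive_sin z).
  by apply: continuous_subspaceT => z; exact: continuous_sin.
rewrite sin0 !subr0 => ->; exists c; last by rewrite mulrC.
by move: cx; rewrite in_itv.
Qed.

Lemma sin_le_id x : 0 < x -> sin x <= x.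
Proof.
move=> x0; have [c _ ->] := sin_mean_value x0.
by rewrite ler_piMr ?cos_le1 ?ltW.
Qed.

(** The elementary bounds below only serve to control [cot y - 1 / y] near [0];
    their constants are crude. *)
Lemma cos_ge_quadratic x : 0 < x -> x < pi -> 1 - x ^+ 2 / 2 <= cos x.
Proof.
move=> x0 xpi.
have -> : cos x = 1 - sin (x / 2) ^+ 2 *+ 2.
  have {1}-> : x = x / 2 *+ 2 by rewrite -[RHS]mulr_natr divfK ?pnatr_eq0.
  rewrite cos_mulr2n.
  by have := cos2Dsin2 (x / 2); lra.
have h0 : 0 < sin (x / 2) by apply: sin_gt0_pi; lra.
have h1 : sin (x / 2) <= x / 2 by apply: sin_le_id; lra.
nra.
Qed.

Lemma sin_ge_cubic x : 0 < x -> x < pi -> x - x ^+ 3 / 2 <= sin x.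
Proof.
move=> x0 xpi; have [c /andP[c0 cx] ->] := sin_mean_value x0.
have := cos_ge_quadratic c0 (lt_trans cx xpi).
have : c ^+ 2 <= x ^+ 2 by rewrite ler_sqr ?nnegrE ltW.
rewrite exprS => cx2 cc; have : 1 - x ^+ 2 / 2 <= cos c by lra.
nra.
Qed.

Lemma sin_ge_quarter x : 0 < x -> x <= pi / 2 -> x / 4 <= sin x.
Proof.
move=> x0 xpi; have pi4 : pi < 4 :> R by have := @pihalf_lt2 R; lra.
have pi0 := @pi_gt0 R; have pi2 := @pi_ge2 R.
have sub1 y : 0 < y -> y <= 1 -> y / 2 <= sin y.
  move=> y0 y1; have := @sin_ge_cubic y y0 ltac:(lra).
  have : y ^+ 3 <= y by rewrite exprS ler_piMr ?exprn_ile1 // ltW.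
  lra.
have [x1|x1] := leP x 1; first by have := sub1 x x0 x1; lra.
have : sin 1 <= sin x.
  by apply/ltW; rewrite ltr_sin // in_itv /=; apply/andP; split; lra.
have := sub1 1 ltr01 (lexx _); lra.
Qed.

(** This is the derivative of [cot y - 1 / y]; it stays bounded at [0] because
    [y] and [sin y] agree to second order. *)
Lemma inv_sin2_sub_inv_sq_bounded x : 0 < x -> x <= pi / 2 ->
  `|x ^- 2 - (sin x) ^- 2| <= 16.
Proof.
move=> x0 xpi; have pi0 := @pi_gt0 R.
have s4 := sin_ge_quarter x0 xpi; have s1 := sin_le_id x0.
have s3 := @sin_ge_cubic x x0 ltac:(lra).
have s0 : 0 < sin x by lra.
have -> : x ^- 2 - sin x ^- 2 = - ((x - sin x) * (x + sin x) / (x * sin x) ^+ 2).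
  by field; rewrite !gt_eqF.
rewrite normrN ger0_norm; last first.
  by apply: divr_ge0; [apply: mulr_ge0; lra | apply: exprn_ge0; nra].
rewrite ler_pdivrMr ?exprn_gt0 ?mulr_gt0 //.
apply: (@le_trans _ _ (x ^+ 3 / 2 * (x + x))).
  by apply: ler_pM; lra.
have -> : x ^+ 3 / 2 * (x + x) = x ^+ 2 * x ^+ 2 by field.
have -> : 16 * (x * sin x) ^+ 2 = x ^+ 2 * (16 * sin x ^+ 2) by ring.
apply: ler_wpM2l; first exact: sqr_ge0.
have : (x / 4) ^+ 2 <= sin x ^+ 2 by rewrite ler_sqr ?nnegrE; lra.
rewrite expr_div_n; lra.
Qed.

Lemma cot_sub_inv_lipschitz u v : 0 < u -> u <= v -> v <= pi / 2 ->
  `|(cot v - v^-1) - (cot u - u^-1)| <= 16 * (v - u).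
Proof.
move=> u0; rewrite le_eqVlt => /predU1P[<- _|uv vpi].
  by rewrite !subrr normr0 mulr0.
have pi0 := @pi_gt0 R.
have D z : 0 < z -> z <= pi / 2 -> is_derive z 1 (fun y : R => cot y - y^-1)
    (z ^- 2 - (sin z) ^- 2).
  move=> z0 zpi.
  have sz : sin z != 0 by rewrite gt_eqF // sin_gt0_pi; lra.
  have z00 : z != 0 by rewrite gt_eqF.
  have := is_deriveB (is_deriveM (is_derive_cos z) (is_deriveV sz (is_derive_sin z)))
    (is_deriveV z00 (is_derive_id z 1)).
  rewrite /cot => d; apply: is_derive_eq.
  rewrite /GRing.scale /=; have := cos2Dsin2 z; move: sz.
  set s := sin z; set c := cos z => s0 cs.
  have c2 : c * c = 1 - s * s by move: cs; rewrite !expr2 => <-; ring.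
  have -> : c * (- s ^- 2 * c) = - s ^- 2 * (c * c) by ring.
  rewrite c2; field; by rewrite s0 z00.
have [|| c] := @MVT R (fun y : R => cot y - y^-1) (fun z => z ^- 2 - (sin z) ^- 2)
   u v uv.
- by move=> z; rewrite in_itv /= => /andP[z1 z2]; apply: D; lra.
- apply: derivable_within_continuous => z; rewrite in_itv /= => /andP[z1 z2].
  by have [] := D z ltac:(lra) ltac:(lra).
rewrite in_itv /= => /andP[c1 c2] ->.
rewrite normrM [`|v - u|]ger0_norm ?subr_ge0 ?(ltW uv) //.
apply: ler_wpM2r; first by rewrite subr_ge0 ltW.
by apply: inv_sin2_sub_inv_sq_bounded; lra.
Qed.

(** Symmetric pairing turns the conditionally convergent two-sided series
    [\sum_q 1 / (x + q)] into an absolutely convergent one. *)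
Definition cot_partial (M : nat) x : R :=
  \sum_(0 <= q < M) ((q%:R + x)^-1 - (q.+1%:R - x)^-1).

Definition cot_remainder (M : nat) x : R := pi * cot (pi * x) - cot_partial M x.

(** The two sums on the right run over the even and the odd terms of the sum on
    the left. *)
Lemma cot_partial_double M x : 0 < x -> x < 1 ->
  cot_partial (2 * M) x =
  (cot_partial M (x / 2) + cot_partial M ((x + 1) / 2)) / 2.
Proof.
move=> x0 x1; elim: M => [|M IH].
  by rewrite /cot_partial muln0 !big_nil addr0 mul0r.
rewrite /cot_partial mulnS add2n !big_nat_recr //= -!/(cot_partial _ _) {}IH.
have M0 : 0 <= M%:R :> R by [].
move: (cot_partial M _) (cot_partial M _) => a b.
have -> : (2 * M).+2%:R = 2 * M%:R + 2 :> R by rewrite -!natr1 natrM; ring.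
have -> : (2 * M).+1%:R = 2 * M%:R + 1 :> R by rewrite -!natr1 natrM; ring.
have -> : M.+1%:R = M%:R + 1 :> R by rewrite -natr1.
rewrite natrM; field.
by do !(apply/andP; split); rewrite ?gt_eqF //; lra.
Qed.

Lemma cot_double y : sin (y *+ 2) != 0 -> cot (y *+ 2) = (cot y + cot (y + pi / 2)) / 2.
Proof.
rewrite /cot sinDpihalf cosDpihalf sin_mulr2n cos_mulr2n => s2.
have [c0 s0] : cos y != 0 /\ sin y != 0.
  by move: s2; rewrite -mulr_natr !mulf_eq0 !negb_or => /andP[/andP[-> ->]].
have -> : cos y ^+ 2 *+ 2 - 1 = cos y ^+ 2 - sin y ^+ 2.
  by have := cos2Dsin2 y; lra.
by field; rewrite c0 s0.
Qed.

Lemma cot_remainder_double M x : 0 < x -> x < 1 ->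
  cot_remainder (2 * M) x =
  (cot_remainder M (x / 2) + cot_remainder M ((x + 1) / 2)) / 2.
Proof.
move=> x0 x1; have pi0 := @pi_gt0 R.
rewrite /cot_remainder cot_partial_double //.
have E : pi * x = (pi * (x / 2)) *+ 2 by rewrite -mulr_natr; field.
rewrite {1}E cot_double; last by rewrite -E gt_eqF // sin_gt0_pi; nra.
have -> : pi * ((x + 1) / 2) = pi * (x / 2) + pi / 2 by field.
ring.
Qed.

Lemma sum_nat_even_odd (F : nat -> R) N :
  \sum_(0 <= j < 2 * N) F j = \sum_(0 <= j < N) (F (2 * j)%N + F (2 * j).+1).
Proof.
elim: N => [|N IH]; first by rewrite muln0 !big_nil.
by rewrite mulnS add2n !big_nat_recr //= IH addrA.
Qed.

(** Iterating the duplication formula turns the remainder into a Riemann sum of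
    a function that is odd about [1/2]. *)
Lemma cot_remainder_pow2 m x : 0 < x -> x < 1 ->
  cot_remainder (2 ^ m) x =
  (\sum_(0 <= j < 2 ^ m) cot_remainder 1 ((x + j%:R) / (2 ^ m)%:R)) / (2 ^ m)%:R.
Proof.
elim: m x => [|m IH] x x0 x1.
  by rewrite expn0 big_nat1 addr0 !divr1.
rewrite expnS cot_remainder_double // !IH; try lra.
have N0 : (2 ^ m)%:R != 0 :> R by rewrite pnatr_eq0 expn_eq0.
have halve a b : (a / (2 ^ m)%:R + b / (2 ^ m)%:R) / 2 = (a + b) / (2 * 2 ^ m)%:R :> R.
  by rewrite natrM; field.
rewrite halve sum_nat_even_odd [in RHS]big_split /=; congr ((_ + _) / _);
  apply: eq_bigr => j _; congr cot_remainder; rewrite -?[(2 * j).+1%:R]natr1 !natrM;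
  by field.
Qed.

Lemma cot_remainder1_sym x : 0 < x -> x < 1 ->
  cot_remainder 1 (1 - x) = - cot_remainder 1 x.
Proof.
move=> x0 x1; rewrite /cot_remainder /cot_partial !big_nat1.
have -> : pi * (1 - x) = - (pi * x) + pi by ring.
rewrite cotDpi cotN.
by field; rewrite !gt_eqF //; lra.
Qed.

Lemma cot_remainder1_lipschitz u v : 0 < u -> u <= v -> v <= 2^-1 ->
  `|cot_remainder 1 v - cot_remainder 1 u| <= (16 * pi ^+ 2 + 4) * (v - u).
Proof.
move=> u0 uv v2; have pi0 := @pi_gt0 R.
have := @cot_sub_inv_lipschitz (pi * u) (pi * v)
  ltac:(nra) ltac:(nra) ltac:(nra).
rewrite /cot_remainder /cot_partial !big_nat1 !add0r => H.
set a := cot (pi * v) in H *; set b := cot (pi * u) in H *.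
have -> : pi * a - (v^-1 - (1 - v)^-1) - (pi * b - (u^-1 - (1 - u)^-1)) =
  pi * (a - (pi * v)^-1 - (b - (pi * u)^-1)) + (v - u) / ((1 - v) * (1 - u)).
  by field; rewrite !gt_eqF //; lra.
rewrite [leRHS]mulrDl; apply: (le_trans (ler_normD _ _)); apply: lerD.
  rewrite normrM gtr0_norm // [16 * _]mulrC expr2 -!mulrA ler_pM2l //.
  by move: H; rewrite -mulrBr mulrCA.
rewrite ger0_norm; last by apply: divr_ge0; nra.
by rewrite mulrC ler_wpM2r ?subr_ge0 // -[4]invrK lef_pV2 ?posrE; nra.
Qed.

(** Terms mirrored about [1/2] cancel up to the Lipschitz constant divided by
    the number of points, uniformly in the term. *)
Lemma cot_remainder_pow2_bound m x : 0 < x -> x < 1 ->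
  `|cot_remainder (2 ^ m.+1) x| <= (16 * pi ^+ 2 + 4) / (2 ^ m.+1)%:R.
Proof.
move=> x0 x1; have pi0 := @pi_gt0 R.
set K := 16 * pi ^+ 2 + 4; have K0 : 0 <= K by rewrite /K; nra.
rewrite cot_remainder_pow2 // expnS; set P := (2 ^ m)%N.
have P0 : 0 < P%:R :> R by rewrite ltr0n expn_gt0.
have N0 : 0 < (2 * P)%:R :> R by rewrite natrM; lra.
rewrite normrM [`|_^-1|]gtr0_norm ?invr_gt0 // ler_pM2r ?invr_gt0 //.
rewrite (@big_cat_nat _ _ _ P) //=; last by rewrite leq_pmull.
(* the terms j and 2P-1-j are values at points mirrored about 1/2 up to 1/2P *)
have -> : \sum_(P <= j < 2 * P) cot_remainder 1 ((x + j%:R) / (2 * P)%:R) =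
   - \sum_(0 <= j < P) cot_remainder 1 ((1 - x + j%:R) / (2 * P)%:R).
  rewrite mul2n -addnn -{1}[P]add0n big_addn addnK big_nat_rev /= add0n -sumrN.
  rewrite !big_nat; apply: eq_bigr => j /andP[_ jP].
  rewrite addnn -mul2n -cot_remainder1_sym.
  - congr cot_remainder.
    have -> : (P - j.+1 + P)%:R = 2 * P%:R - 1 - j%:R :> R.
      by rewrite natrD natrB // -natr1; ring.
    by rewrite natrM; field; rewrite gt_eqF.
  - by apply: divr_gt0 => //; have : 0 <= j%:R :> R by []; lra.
  - rewrite ltr_pdivrMr // mul1r natrM.
    have : j%:R + 1 <= P%:R :> R by rewrite natr1 ler_nat.
    lra.
rewrite -sumrB; apply: (le_trans (ler_norm_sum _ _ _)).
apply: (@le_trans _ _ (\sum_(0 <= j < P) (K / (2 * P)%:R))); last first.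
  rewrite sumr_const_nat subn0.
  have -> : K / (2 * P)%:R *+ P = K / 2.
    by rewrite -[LHS]mulr_natr natrM; field; rewrite gt_eqF.
  lra.
rewrite !big_nat; apply: ler_sum => j /andP[_ jP].
have j0 : 0 <= j%:R :> R by [].
have j1 : j%:R + 1 <= P%:R :> R by rewrite natr1 ler_nat.
have main u v : 0 < u -> u <= v -> v < 1 -> `|cot_remainder 1 ((v + j%:R) / (2 * P)%:R) -
   cot_remainder 1 ((u + j%:R) / (2 * P)%:R)| <= K / (2 * P)%:R.
  move=> u0 uv v1; apply: (le_trans (cot_remainder1_lipschitz _ _ _)).
  - by apply: divr_gt0 => //; lra.
  - by rewrite ler_pM2r ?invr_gt0 //; lra.
  - by rewrite ler_pdivrMr // natrM; lra.
  rewrite -/K -mulrBl ler_wpM2l //.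
  rewrite -[leRHS]mul1r ler_pM2r ?invr_gt0 //; lra.
have [h|h] := leP x (1 - x); last by apply: main; lra.
by rewrite distrC; apply: main; lra.
Qed.

(** The terms have the sign of [1 - 2 x], so it is enough to know the limit
    along powers of two. *)
Lemma cvg_cot_partial x : 0 < x -> x < 1 ->
  (cot_partial M x @[M --> \oo] --> pi * cot (pi * x))%classic.
Proof.
wlog: x / x <= 2^-1 => [hw x0 x1|x2 x0 x1].
  have [|h] := leP x 2^-1; first by move/hw; apply.
  have := hw (1 - x) ltac:(lra) ltac:(lra) ltac:(lra).
  have -> : cot_partial ^~ (1 - x) = (fun M => - cot_partial M x).
    apply/funext => M; rewrite /cot_partial -sumrN; apply: eq_bigr => q _.
    rewrite opprB opprB !addrA natr1; congr (_ - _).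
    by rewrite -natr1; congr (_^-1); ring.
  have -> : pi * (1 - x) = - (pi * x) + pi by ring.
  rewrite cotDpi cotN mulrN => H.
  rewrite -[pi * _]opprK; under eq_fun do rewrite -[cot_partial _ _]opprK.
  exact: cvgN.
(* the case x <= 1/2: the partial sums increase *)
have pow2_cvg : (cot_partial (2 ^ m.+1) x @[m --> \oo] --> pi * cot (pi * x))%classic.
  apply/cvgrPdist_le => e e0.
  have pi0 := @pi_gt0 R.
  near=> m; rewrite -/(cot_remainder _ _).
  apply: (le_trans (cot_remainder_pow2_bound _ _ _)) => //.
  rewrite ler_pdivrMr ?ltr0n ?expn_gt0 // -ler_pdivrMl //.
  apply: (@le_trans _ _ m%:R); last by rewrite ler_nat ltnW // ltnW // ltn_expl.
  by near: m; exact: nbhs_infty_ger.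
have homo : {homo (cot_partial ^~ x) : n m / (n <= m)%N >-> n <= m}.
  apply/nondecreasing_seqP => M; rewrite /cot_partial big_nat_recr //= lerDl.
  have M0 : 0 <= M%:R :> R by [].
  rewrite subr_ge0 lef_pV2 ?posrE -?natr1; lra.
have bnd : has_ubound (range (cot_partial ^~ x)).
  exists (pi * cot (pi * x)) => _ [M _ <-].
  rewrite -(cvg_lim _ pow2_cvg) //; apply: limr_ge.
    by apply/cvg_ex; eexists; exact: pow2_cvg.
  near=> m; apply: homo; apply: (@leq_trans m); last by rewrite ltnW // ltnW // ltn_expl.
  by near: m; exact: nbhs_infty_ge.
have cv := nondecreasing_is_cvgn homo bnd.
suff <- : limn (cot_partial ^~ x) = pi * cot (pi * x) by [].
apply: (cvg_unique _ _ pow2_cvg) => //.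
apply: (@cvg_comp _ _ _ (fun m => (2 ^ m.+1)%N) (cot_partial ^~ x) _ _ _ _ cv).
apply/cvgnyPge => A; near=> m.
apply: (@leq_trans m); last by rewrite ltnW // ltnW // ltn_expl.
by near: m; exact: nbhs_infty_ge.
Unshelve. all: by end_near. Qed.

End Cotangent.

(** * The series of an odd periodic function *)

Section OddPeriodicSeries.
Context {R : realType}.
Local Notation C := (R[i] : numFieldType).

Lemma cvg_real_complex {T : Type} {F : set_system T} {FF : Filter F}
    (u : T -> R) (l : R) :
  (u x @[x --> F] --> l)%classic -> (((u x)%:C : C) @[x --> F] --> (l%:C : C))%classic.
Proof.
move=> /cvgrPdist_lt ul; apply/cvgrPdist_lt => e.
rewrite ltcE => /andP[/eqP /= e1 e0]; apply: filterS (ul _ e0) => x.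
by rewrite -rmorphB /= normc_def /= expr0n addr0 sqrtr_sqr ltcE /= e1 eqxx.
Qed.

Variables (n : nat) (f : nat -> R[i]).
Hypotheses (n_gt0 : (0 < n)%N) (f_periodic : forall m, f (m + n)%N = f m)
  (f0 : f 0%N = 0) (f_odd : forall a, (0 < a < n)%N -> f (n - a)%N = - f a).

Let s K : R[i] := \sum_(0 <= m < K) f m / m%:R.

Let f_periodicM q m : f (q * n + m)%N = f m.
Proof.
by elim: q => [|q IH] //; rewrite mulSn -addnA addnC f_periodic.
Qed.

Let s_block q : s (q * n) = \sum_(0 <= j < q) \sum_(0 <= a < n) f a / (j * n + a)%:R.
Proof.
elim: q => [|q IH]; first by rewrite mul0n /s !big_nil.
rewrite big_nat_recr //= -IH /s mulSn addnC.
rewrite (@big_cat_nat _ _ _ (q * n)) ?leq_addr //=; congr (_ + _).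
rewrite -{1}[(q * n)%N]add0n [(q * n + n)%N]addnC big_addn addnK.
by apply: eq_bigr => a _; rewrite addnC f_periodicM.
Qed.

(** Oddness pairs the residues [a] and [n - a], which produces the paired terms
    of the cotangent series at [a / n]. *)
Let block_pair j : \sum_(0 <= a < n) f a / (j * n + a)%:R =
  (2 * n%:R)^-1 * \sum_(1 <= a < n) f a *
    ((j%:R + a%:R / n%:R)^-1 - (j.+1%:R - a%:R / n%:R)^-1 : R)%:C.
Proof.
have n0 : 0 < n%:R :> R[i] by rewrite ltr0n.
rewrite big_ltn // f0 mul0r add0r.
apply: (@mulfI _ 2); first by rewrite pnatr_eq0.
rewrite mulr_natl mulr2n {2}big_nat_rev /= -big_split /= mulr_sumr mulr_sumr !big_nat.
apply: eq_bigr => a /andP[a0 an].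
have nR : n%:R != 0 :> R by rewrite pnatr_eq0 -lt0n.
have P0 : (j * n + a)%N != 0%N by rewrite -lt0n addn_gt0 a0 orbT.
have Q0 : (j * n + (n - a))%N != 0%N by rewrite -lt0n addn_gt0 subn_gt0 an orbT.
have -> : (j%:R + a%:R / n%:R)^-1 = n%:R / (j * n + a)%:R :> R.
  have : (j * n + a)%:R != 0 :> R by rewrite pnatr_eq0.
  by rewrite natrD natrM => P; field; rewrite P nR.
have -> : (j.+1%:R - a%:R / n%:R)^-1 = n%:R / (j * n + (n - a))%:R :> R.
  have : (j * n + (n - a))%:R != 0 :> R by rewrite pnatr_eq0.
  rewrite natrD natrM natrB 1?ltnW // -natr1 => Q; field.
  by rewrite nR ?andbT /=; apply: contra_neq Q => E; lra.
rewrite add1n subSS f_odd ?a0 // rmorphB /= !fmorph_div /= !rmorph_nat.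
have {}P0 : (j * n + a)%:R != 0 :> R[i] by rewrite pnatr_eq0.
have {}Q0 : (j * n + (n - a))%:R != 0 :> R[i] by rewrite pnatr_eq0.
move: (j * n + a)%:R (j * n + (n - a))%:R P0 Q0 => P Q P0 Q0.
by field; rewrite P0 Q0 gt_eqF.
Qed.

Let block_limit : R[i] :=
  pi%:C / (2 * n%:R) * \sum_(1 <= a < n) f a * (cot (a%:R * pi / n%:R : R))%:C.

Let cvg_s_block : ((s (q * n) : C) @[q --> \oo] --> (block_limit : C))%classic.
Proof.
have nR : 0 < n%:R :> R by rewrite ltr0n.
have -> : (fun q => s (q * n) : C) = (fun q => (2 * n%:R)^-1 *
    \sum_(1 <= a < n) f a * (cot_partial q (a%:R / n%:R : R))%:C).
  apply/funext => q; rewrite s_block (eq_bigr _ (fun j _ => block_pair j)) -mulr_sumr.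
  rewrite exchange_big /=; congr (_ * _); apply: eq_bigr => a _.
  by rewrite -mulr_sumr /cot_partial -rmorph_sum.
have -> : block_limit = (2 * n%:R)^-1 *
    \sum_(1 <= a < n) f a * (pi * cot (pi * (a%:R / n%:R)) : R)%:C.
  rewrite /block_limit [_ / _]mulrC -mulrA; congr (_ * _).
  rewrite mulr_sumr; apply: eq_bigr => a _.
  have -> : a%:R * pi / n%:R = pi * (a%:R / n%:R) :> R by ring.
  by rewrite [(pi * _)%:C]rmorphM mulrCA.
apply: (@cvgMl_tmp C); rewrite big_nat; under eq_fun do rewrite big_nat.
apply: cvg_big; first exact: add_continuous.
move=> a /andP[a0 an].
apply: (@cvgMl_tmp C); apply: cvg_real_complex; apply: cvg_cot_partial.
  by rewrite divr_gt0 // ltr0n.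
by rewrite ltr_pdivrMr // mul1r ltr_nat.
Qed.

(** An incomplete block has fewer than [n] terms, each of size [O(n / K)]. *)
Let s_tail K : (0 < K %/ n)%N ->
  `|s (K %/ n * n) - s K| <= ((\sum_(0 <= a < n) `|f a|) / (K %/ n)%:R).
Proof.
set q := (K %/ n)%N => q0.
rewrite /s (@big_cat_nat _ _ _ (q * n) 0 K) ?leq_divM //= opprD addNKr normrN.
rewrite -{1}[(q * n)%N]add0n big_addn.
have KE : (K - q * n = K %% n)%N by rewrite {1}(divn_eq K n) addKn.
rewrite KE mulr_suml (@big_cat_nat _ _ _ (K %% n) 0 n) //=; last exact: ltnW (ltn_pmod _ _).
apply: (le_trans (ler_norm_sum _ _ _)).
apply: (@le_trans _ _ (\sum_(0 <= a < K %% n) `|f a| / q%:R)); last first.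
  by rewrite lerDl sumr_ge0 // => a _; rewrite divr_ge0.
apply: ler_sum => a _; rewrite addnC f_periodicM normrM ler_wpM2l // normfV normr_nat.
rewrite lef_pV2 ?posrE ?ltr0n // ?addn_gt0 ?muln_gt0 ?q0 ?n_gt0 // ler_nat.
by rewrite (leq_trans _ (leq_addr _ _)) // leq_pmulr.
Qed.

(** Convergence is only conditional: the partial sums at multiples of [n]
    converge by pairing, and the others are close to them. *)
Lemma cvg_odd_periodic_series :
  ((series (fun k => f k.+1 * k.+1%:R^-1) : nat -> C) @ \oo -->
    (pi%:C / (2 * n%:R) *
     \sum_(1 <= a < n) f a * (cot (a%:R * pi / n%:R : R))%:C : C))%classic.
Proof.
rewrite -/block_limit.
have -> : (series (fun k => f k.+1 * k.+1%:R^-1) : nat -> C) = (fun K => s K.+1).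
  by apply/funext => K; rewrite /series /= /s big_nat_recl //= f0 mul0r add0r.
rewrite (cvg_shiftS (s : nat -> C)).
have div_cvg : ((K %/ n)%N @[K --> \oo] --> \oo)%classic.
  apply/cvgnyPge => A; near=> K; rewrite leq_divRL //.
  by near: K; exact: nbhs_infty_ge.
have inv_cvg : ((q%:R^-1 : R) @[q --> \oo] --> 0)%classic.
  apply/gtr0_cvgV0; last exact: cvgr_idn.
  by near=> q; rewrite ltr0n; near: q; exact: nbhs_infty_gt.
have tail_cvg : (((\sum_(0 <= a < n) `|f a|) * ((K %/ n)%:R^-1 : R)%:C : C)
    @[K --> \oo] --> (0 : C))%classic.
  rewrite -[0 in X in (_ --> X)%classic](mulr0 (\sum_(0 <= a < n) `|f a|)).
  apply: (@cvgMl_tmp C); rewrite -[0]/((0 : R)%:C); apply: cvg_real_complex.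
  exact: (@cvg_comp _ _ _ (fun K => K %/ n)%N (fun q => q%:R^-1 : R)
    _ _ _ div_cvg inv_cvg).
have blk := @cvg_comp _ _ _ (fun K => K %/ n)%N (fun q => s (q * n) : C)
  _ _ _ div_cvg cvg_s_block.
apply/cvgrPdist_lt => e e0.
near=> K.
have q0 : (0 < K %/ n)%N.
  by near: K; apply: (div_cvg [set q | (0 < q)%N]%classic); exact: nbhs_infty_gt.
rewrite -(subrKA (s (K %/ n * n))) [e]splitr.
apply: (le_lt_trans (ler_normD _ _)); apply: ltrD.
  by near: K; move/cvgrPdist_lt : blk; apply; rewrite divr_gt0.
apply: (le_lt_trans (s_tail q0)).
have -> : (\sum_(0 <= a < n) `|f a|) / (K %/ n)%:R =
   `|0 - (\sum_(0 <= a < n) `|f a|) * ((K %/ n)%:R^-1 : R)%:C|.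
  rewrite sub0r normrN fmorphV rmorph_nat ger0_norm //.
  by rewrite divr_ge0 // sumr_ge0.
by near: K; move/cvgrPdist_lt : tail_cvg; apply; rewrite divr_gt0.
Unshelve. all: by end_near. Qed.

End OddPeriodicSeries.

(** * Matrices of finite order *)

Section FiniteOrder.
Context {F : numClosedFieldType}.

(** The polynomial [X^m - 1] splits with simple roots. The power is written with
    [iter] because square matrices form a ring only in positive size. *)
Lemma diagonalizable_finite_order h (M : 'M[F]_h) m : (0 < m)%N ->
  iter m (mulmx M) 1%:M = 1%:M -> diagonalizable M.
Proof.
case: h M => [|h] M m0 Mm.
  by exists 1%:M; rewrite ?unitmx1 //; apply/is_diag_mxP => -[].
apply/diagonalizableP.
have [r rE] := closed_field_poly_normal ('X^m - 1 : {poly F}).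
have lc : lead_coef ('X^m - 1 : {poly F}) = 1 by apply/eqP; exact: monic_Xn_sub_1.
rewrite lc scale1r in rE.
exists r.
  rewrite -(@separable.separable_prod_XsubC F) -rE.
  by apply: separable_Xn_sub_1; rewrite pnatr_eq0 -lt0n.
rewrite -rE; apply: mxminpoly_min; rewrite rmorphB rmorph1 rmorphXn /= horner_mx_X.
apply/eqP; rewrite subr_eq0 -[X in _ == X]Mm; apply/eqP.
by elim: m {m0 Mm r rE lc} => [|m IH] //; rewrite exprS IH.
Qed.

(** An involution is diagonalizable with eigenvalues [1] and [-1], and both its
    trace and its determinant count the eigenvalues [-1]. *)
Lemma det_involution h (J : 'M[F]_h) : J *m J = 1%:M ->
  exists m : nat, \tr J + (2 * m)%:R = h%:R /\ \det J = (-1) ^+ m.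
Proof.
move=> JJ; have [|P Pu /diagonalizable_forPex[d /(simmxP Pu) PJ]] :=
  @diagonalizable_finite_order h J 2 isT; first by rewrite /= mulmx1.
have JE : J = invmx P *m (diag_mx d *m P) by rewrite -PJ mulKmx.
have dd : diag_mx d *m diag_mx d = 1%:M.
  have : P *m J *m J = diag_mx d *m diag_mx d *m P.
    by rewrite -[RHS]mulmxA -PJ mulmxA -PJ.
  rewrite -mulmxA JJ mulmx1 => /(congr1 (mulmx^~ (invmx P))).
  by rewrite mulmxK // mulmxV // => ->.
have d1 i : (d 0 i == 1) || (d 0 i == -1).
  rewrite -eqf_sqr expr1n; apply/eqP; move/matrixP/(_ i i): dd.
  by rewrite mulmx_diag !mxE eqxx mulr1n -expr2 => ->.
have dE i : d 0 i = (-1) ^+ (d 0 i == -1).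
  have n1 : (1 == -1 :> F) = false by rewrite -subr_eq0 opprK (pnatr_eq0 _ 2).
  by case/orP: (d1 i) => /eqP ->; rewrite ?eqxx // n1.
exists (\sum_i nat_of_bool (d 0 i == -1)%R)%N; split.
  rewrite JE mxtrace_mulC -mulmxA mulmxV // mulmx1 mxtrace_diag natrM natr_sum mulr_sumr.
  rewrite -big_split /= (eq_bigr (fun=> 1)) => [|i _]; first by rewrite sumr_const card_ord.
  by rewrite {1}dE; case: (d 0 i == -1) => /=; rewrite ?expr0 ?expr1; ring.
rewrite JE !det_mulmx mulrCA -det_mulmx mulVmx // det1 mulr1 det_diag -prodrXr.
by apply: eq_bigr => i _; rewrite -dE.
Qed.

End FiniteOrder.

(** * Odd functions on the units modulo n *)

Lemma Zp_nat_eq0 n m : (1 < n)%N -> ((m%:R : 'Z_n) == 0) = (n %| m)%N.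
Proof. by move=> n1; rewrite -val_eqE /= val_Zp_nat. Qed.

Lemma card_units_mod n : (1 < n)%N -> #|(GRing.unit : {pred 'Z_n})| = totient n.
Proof.
case: n => [|[|n]] // _; rewrite -sum1_card big_mkcond totient_count_coprime big_mkord.
by apply: eq_bigr => x _; rewrite -{1}[x]natr_Zp unitZpE //; case: coprime.
Qed.

(** Every class prime to [n] is one of these representatives or its opposite. *)
Definition half_rep n (s : 'I_#|half_units n|) : 'Z_n := (enum_val s)%:R.

Section HalfUnits.
Variable n : nat.
Hypotheses (n_gt2 : (2 < n)%N) (n_odd : odd n).
Local Notation h := #|half_units n|.
Local Notation r := (@half_rep n).
Local Notation unit := (GRing.unit : {pred 'Z_n}).

Let n_gt1 : (1 < n)%N. Proof. exact: ltnW. Qed.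

Lemma half_rep_unit s : r s \in unit.
Proof.
rewrite unitZpE //; have := enum_valP s; rewrite inE coprime_sym.
by case/and3P.
Qed.

Lemma half_rep_neq_opp s t : r s <> - r t.
Proof.
move=> /eqP; rewrite -addr_eq0 -natrD Zp_nat_eq0 //.
have := enum_valP s; have := enum_valP t; rewrite !inE => /and3P[t0 tn _] /and3P[s0 sn _].
by move/dvdn_leq; lia.
Qed.

Lemma half_rep_inj : injective r.
Proof.
move=> s t /(congr1 (@nat_of_ord _)); rewrite !val_Zp_nat // !modn_small //.
by move/val_inj/enum_val_inj.
Qed.

Lemma half_repP x : x \in unit -> exists s, x = r s \/ x = - r s.
Proof.
move=> xu; have xE : x = (x : nat)%:R by rewrite natr_Zp.
have xn : (x < n)%N by have := ltn_ord x; rewrite {2}Zp_cast.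
have xc : coprime n x by rewrite -unitZpE // -xE.
have x0 : (0 < x)%N.
  by rewrite lt0n; apply: contraTneq xc => ->; rewrite /coprime gcdn0 gtn_eqF.
have [x2|x2] := leqP (2 * x) n.
  have xS : Ordinal xn \in half_units n.
    rewrite inE /= x0 coprime_sym xc andbT ltn_neqAle x2 andbT.
    by apply: contraTneq n_odd => <-; rewrite oddM.
  by exists (enum_rank_in xS (Ordinal xn)); left; rewrite /half_rep enum_rankK_in.
have yn : (n - x < n)%N by lia.
have yS : Ordinal yn \in half_units n.
  rewrite inE /= coprime_sym -unitZpE // natrB ?(ltnW xn) // natr_Zp pchar_Zp //.
  by rewrite sub0r unitrN xu andbT; lia.
exists (enum_rank_in yS (Ordinal yn)); right.
rewrite /half_rep enum_rankK_in //= natrB ?(ltnW xn) //.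
by rewrite natr_Zp pchar_Zp // sub0r opprK.
Qed.

(** Reduces sums over [half_units n] of the even functions met below to sums over the
    whole group of units, where translations are bijections. *)
Lemma sum_units_even (V : nmodType) (u : 'Z_n -> V) : (forall x, u (- x) = u x) ->
  \sum_(x in unit) u x = (\sum_s u (r s)) *+ 2.
Proof.
move=> uN.
set A := (r @: [set: 'I_h])%SET; set B := ((fun s => - r s) @: [set: 'I_h])%SET.
have -> : \sum_(x in unit) u x = \sum_(x in [predU A & B]) u x.
  apply: eq_bigl => x; rewrite !inE; apply/idP/orP.
    by move=> /half_repP[s [] ->]; [left | right]; apply/imsetP; exists s.
  by case=> /imsetP[s _ ->]; rewrite ?unitrN half_rep_unit.
rewrite bigU /=; last first.
  rewrite disjoint_subset; apply/fintype.subsetP => x /imsetP[s _ ->].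
  by rewrite inE; apply/imsetP => -[t _]; exact: half_rep_neq_opp.
rewrite !big_imset /=; first last.
- by move=> s t _ _; exact: half_rep_inj.
- by move=> s t _ _ /oppr_inj; exact: half_rep_inj.
rewrite (eq_bigr _ (fun s _ => uN (r s))) mulr2n; congr (_ + _);
  by apply: eq_bigl => s; rewrite inE.
Qed.

Lemma card_half_units : totient n = (h * 2)%N.
Proof.
have := @sum_units_even int (fun=> 1) (fun=> erefl).
rewrite !sumr_const card_units_mod // card_ord -mulrnA => /eqP.
by rewrite eqr_nat => /eqP.
Qed.

End HalfUnits.

(** * Linear operators on odd functions *)

Section OddFunctions.
Context {F : numClosedFieldType}.
Variable n : nat.
Hypotheses (n_gt2 : (2 < n)%N) (n_odd : odd n).
Local Notation h := #|half_units n|.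
Local Notation r := (@half_rep n).
Local Notation unit := (GRing.unit : {pred 'Z_n}).

Let n_gt1 : (1 < n)%N. Proof. exact: ltnW. Qed.

(** The odd function on units that is [1] at the representative of [s] and
    vanishes at the other representatives. *)
Definition half_delta (s : 'I_h) (x : 'Z_n) : F := (x == r s)%:R - (x == - r s)%:R.
Local Notation E := half_delta.

Lemma half_deltaN s x : E s (- x) = - E s x.
Proof. by rewrite /half_delta eqr_oppLR eqr_opp opprB. Qed.

Lemma half_delta_rep s t : E s (r t) = (s == t)%:R.
Proof.
rewrite /half_delta (inj_eq (@half_rep_inj n n_gt2)) eq_sym.
by case: (r t =P - r s) => [/half_rep_neq_opp-/(_ n_gt2)|_]; rewrite ?subr0.
Qed.

Lemma half_delta_nonunit s x : x \notin unit -> E s x = 0.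
Proof.
move=> xu; rewrite /half_delta !(negbTE (contraNneq _ xu)) ?subr0 // => ->;
  by rewrite ?unitrN half_rep_unit.
Qed.

Lemma odd_expansion (phi : 'Z_n -> F) x : (forall y, phi (- y) = - phi y) ->
  x \in unit -> \sum_s phi (r s) * E s x = phi x.
Proof.
move=> phiN.
have rep t : \sum_s phi (r s) * E s (r t) = phi (r t).
  rewrite (bigD1 t) //= half_delta_rep eqxx mulr1 big1 ?addr0 // => s st.
  by rewrite half_delta_rep (negbTE st) mulr0.
move=> /half_repP-/(_ n_gt2 n_odd)[t [] ->] //.
rewrite phiN -rep -sumrN; apply: eq_bigr => s _.
by rewrite half_deltaN mulrN.
Qed.

Lemma eq_odd (phi psi : 'Z_n -> F) :
  (forall x, phi (- x) = - phi x) -> (forall x, psi (- x) = - psi x) ->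
  (forall s, phi (r s) = psi (r s)) -> {in unit, phi =1 psi}.
Proof.
move=> phiN psiN rep x xu; rewrite -(odd_expansion phiN xu) -(odd_expansion psiN xu).
by apply: eq_bigr => s _; rewrite rep.
Qed.

(** Translation by [g] on odd functions, in the basis [half_delta]. *)
Definition translation_mx (g : 'Z_n) : 'M[F]_h := \matrix_(s, t) E s (g * r t).

Lemma translation_mxM g k : k \in unit ->
  translation_mx g *m translation_mx k = translation_mx (g * k).
Proof.
move=> ku; apply/matrixP => s u; rewrite !mxE.
under eq_bigr do rewrite !mxE.
rewrite (@odd_expansion (fun x => E s (g * x))) ?mulrA //.
  by move=> x; rewrite mulrN half_deltaN.
by rewrite unitrM ku half_rep_unit.
Qed.

Lemma translation_mx1 : translation_mx 1 = 1%:M.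
Proof. by apply/matrixP => s t; rewrite !mxE mul1r half_delta_rep. Qed.

Lemma unit_expr_totient g : g \in unit -> g ^+ totient n = 1 :> 'Z_n.
Proof.
rewrite -[g]natr_Zp unitZpE // coprime_sym => gn.
rewrite -natrX -Zp_nat_mod // cyclic.Euler_exp_totient //.
by rewrite Zp_nat_mod.
Qed.

Lemma diagonalizable_translation_mx g : g \in unit -> diagonalizable (translation_mx g).
Proof.
move=> gu; apply: (@diagonalizable_finite_order _ _ _ (totient n)).
  by rewrite totient_gt0 ltnW.
have -> m : iter m (mulmx (translation_mx g)) 1%:M = translation_mx (g ^+ m).
  elim: m => [|m IH]; first by rewrite expr0 translation_mx1.
  by rewrite /= IH translation_mxM ?exprS // unitrX.
by rewrite unit_expr_totient // translation_mx1.
Qed.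

(** Inversion of units, acting on odd functions. *)
Definition inversion_mx : 'M[F]_h := \matrix_(s, t) E s (r t)^-1.

Lemma inversion_mxK : inversion_mx *m inversion_mx = 1%:M.
Proof.
apply/matrixP => s u; rewrite !mxE; under eq_bigr do rewrite !mxE.
rewrite (@odd_expansion (fun x => E s x^-1)) ?invrK ?half_delta_rep //.
  by move=> x; rewrite invrN half_deltaN.
by rewrite unitrV half_rep_unit.
Qed.

Definition sqrt_classes (c : 'Z_n) := [set x : 'Z_n | x * x == c]%SET.

(** A diagonal entry detects the representatives with [x^-1 = x], counted
    positively, and those with [x^-1 = - x], counted negatively. *)
Lemma trace_inversion_mx : (\tr inversion_mx) *+ 2 =
  #|sqrt_classes 1|%:R - #|sqrt_classes (-1)|%:R.
Proof.
pose u (x : 'Z_n) : F := (x^-1 == x)%:R - (x^-1 == - x)%:R.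
have -> : \tr inversion_mx = \sum_s u (r s) by apply: eq_bigr => s _; rewrite mxE.
rewrite -sum_units_even //; last first.
  by move=> x; rewrite /u invrN eqr_opp opprK eqr_oppLR.
have count c : c * c = 1 ->
    \sum_(x in unit) (x^-1 == c * x)%:R = #|sqrt_classes c|%:R :> F.
  move=> cc; rewrite -sum1_card natr_sum big_mkcond [RHS]big_mkcond.
  have cu : c \is a GRing.unit by apply/unitrP; exists c.
  apply: eq_bigr => x _; rewrite inE.
  have [xu|xu] := boolP (x \in unit).
    rewrite -(inj_eq (mulIr xu)) mulVr // -mulrA -(inj_eq (mulrI cu)).
    rewrite mulr1 mulrA cc mul1r eq_sym.
    by case: eqP.
  case: eqP => // xx; rewrite -xx unitrM in cu.
  by case/andP: cu xu => ->.
rewrite /u sumrB; congr (_ - _).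
  by rewrite -count ?mulr1 //; apply: eq_bigr => x _; rewrite mul1r.
by rewrite -count ?mulrNN ?mulr1 //; apply: eq_bigr => x _; rewrite mulN1r.
Qed.

(** The relation between the numbers of square roots of [1] and of [-1] is a
    by-product, obtained by comparing the trace with the size. *)
Lemma det_inversion_mx : exists m : nat,
  (totient n + #|sqrt_classes (-1)%R| = #|sqrt_classes 1%R| + 4 * m)%N /\
  \det inversion_mx = (-1) ^+ m.
Proof.
have [m [trm detm]] := det_involution inversion_mxK; exists m; split=> //.
have := congr1 (fun z => z *+ 2) trm; rewrite mulrnDl trace_inversion_mx.
rewrite -!mulrnA -card_half_units // => /eqP.
rewrite -addrA [- _ + _]addrC addrA subr_eq -!natrD eqr_nat => /eqP.
by move=> <-; lia.
Qed.

End OddFunctions.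

(** * Diagonalization by the odd characters *)

Section OddCharacters.
Context {R : realType}.
Variable n : nat.
Hypotheses (n_gt2 : (2 < n)%N) (n_odd : odd n).
Local Notation F := R[i].
Local Notation h := #|half_units n|.
Local Notation r := (@half_rep n).
Local Notation E := half_delta.
Local Notation unit := (GRing.unit : {pred 'Z_n}).

Lemma odd_characterN (chi : {ffun 'Z_n -> F}) x :
  odd_characters R n chi -> chi (- x) = - chi x.
Proof. by move=> [[_ chiM _] chiN]; rewrite -mulN1r chiM chiN mulN1r. Qed.

Lemma character_nonunit (chi : {ffun 'Z_n -> F}) x :
  dirichlet_character chi -> x \notin unit -> chi x = 0.
Proof. by move=> [_ _ chiu]; rewrite -chiu negbK => /eqP. Qed.

(** A common eigenvector of the translations is an odd function [phi] with
    [phi (g x) = lambda_g phi x]; evaluating at [x = 1] shows that it is a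
    multiple of a character. *)
Lemma odd_characters_basis : exists chi : 'I_h -> {ffun 'Z_n -> F},
  (forall i, odd_characters R n (chi i)) /\
  (\matrix_(i, s) chi i (r s)) \in unitmx.
Proof.
have [X Xu /allP Xdiag] :
    codiagonalizable [seq translation_mx g : 'M[F]_h | g <- enum unit].
  apply/codiagonalizableP; split.
    move=> _ _ /mapP[g gu ->] /mapP[k ku ->]; rewrite !mem_enum in gu ku.
    by rewrite /comm_mx !(translation_mxM n_gt2 n_odd) // mulrC.
  by move=> _ /mapP[g gu ->]; rewrite mem_enum in gu; 
    exact: (diagonalizable_translation_mx n_gt2 n_odd).
pose phi i x : F := \sum_s X i s * E s x.
have phiN i x : phi i (- x) = - phi i x.
  by rewrite /phi -sumrN; apply: eq_bigr => s _; rewrite half_deltaN mulrN.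
have phi_nonunit i x : x \notin unit -> phi i x = 0.
  by move=> xu; rewrite /phi big1 // => s _; rewrite (half_delta_nonunit n_gt2) ?mulr0.
have phi_rep i s : phi i (r s) = X i s.
  rewrite /phi (bigD1 s) //= (half_delta_rep n_gt2 n_odd) eqxx mulr1 big1 ?addr0 // => t st.
  by rewrite (half_delta_rep n_gt2 n_odd) (negbTE st) mulr0.
have eigen i g : g \in unit -> exists c, {in unit, forall x, phi i (g * x) = c * phi i x}.
  move=> gu; have /Xdiag /diagonalizable_forPex[d /(simmxP Xu) Xd] :
      translation_mx g \in [seq translation_mx g : 'M[F]_h | g <- enum unit].
    by apply: map_f; rewrite mem_enum.
  exists (d 0 i); apply: (eq_odd n_gt2 n_odd) => [x|x|s].
  - by rewrite mulrN phiN.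
  - by rewrite phiN mulrN.
  - move/matrixP/(_ i s): Xd; rewrite mul_diag_mx !mxE -phi_rep => <-.
    by apply: eq_bigr => t _; rewrite mxE.
have phi1 i : phi i 1 != 0.
  apply: contraTneq Xu => phi10; rewrite -row_free_unit.
  apply/negP => /row_freeP[Y XY].
  have : row i (X *m Y) = 0.
    rewrite row_mul; suff -> : row i X = 0 by rewrite mul0mx.
    apply/rowP => s; rewrite !mxE -phi_rep.
    have [c cE] := eigen i _ (half_rep_unit n_gt2 s).
    by have := cE 1 (unitr1 _); rewrite mulr1 phi10 mulr0.
  by rewrite XY => /rowP/(_ i)/eqP; rewrite !mxE eqxx oner_eq0.
have phiM i x y : phi i (x * y) * phi i 1 = phi i x * phi i y.
  have [xu|xu] := boolP (x \in unit); last first.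
    by rewrite (phi_nonunit i x) // (phi_nonunit i (x * y)) ?mul0r // unitrM negb_and xu.
  have [yu|yu] := boolP (y \in unit); last first.
    rewrite (phi_nonunit i y) // (phi_nonunit i (x * y)) ?mul0r ?mulr0 //.
    by rewrite unitrM negb_and yu orbT.
  have [c cE] := eigen i x xu; have := cE 1 (unitr1 _); rewrite mulr1 cE // => ->.
  by rewrite mulrAC.
have phi_neq0 i x : x \in unit -> phi i x != 0.
  move=> xu; have := phiM i x x^-1; rewrite divrr // => /eqP.
  by apply: contraTneq => ->; rewrite mul0r mulf_neq0.
exists (fun i => [ffun x => phi i x / phi i 1]); split.
  move=> i; split; last by rewrite ffunE phiN mulNr divff.
  split; first by rewrite ffunE divff.
    move=> x y; rewrite !ffunE; apply: (mulIf (phi1 i)).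
    by rewrite mulrAC -(mulrA _ _ (phi i 1)) phiM; field; rewrite phi1.
  move=> x; rewrite ffunE mulf_eq0 invr_eq0 (negbTE (phi1 i)) orbF.
  by have [/phi_neq0->|/phi_nonunit->] := boolP (x \in unit); rewrite ?eqxx.
have : X = diag_mx (\row_i phi i 1) *m (\matrix_(i, s) [ffun x => phi i x / phi i 1] (r s)).
  apply/matrixP => i s; rewrite mul_diag_mx !mxE ffunE phi_rep.
  by field; rewrite phi1.
by move=> XE; move: Xu; rewrite XE unitmx_mul => /andP[].
Qed.

(** By independence, an expansion of an odd character on this basis can only
    involve characters that agree with it. *)
Lemma odd_characters_complete (chi : 'I_h -> {ffun 'Z_n -> F}) :
  (forall i, odd_characters R n (chi i)) ->
  (\matrix_(i, s) chi i (r s)) \in unitmx ->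
  set_bij [set: 'I_h] (odd_characters R n) chi.
Proof.
move=> chiP Xu; split=> [i _|i j _ _ ij|psi psiP]; first exact: chiP.
  apply/eqP; apply: contraTT Xu => nij; rewrite unitmxE.
  by rewrite (determinant_alternate nij) ?unitr0 // => s; rewrite !mxE ij.
set X := (\matrix_(i, s) chi i (r s)) in Xu.
pose w := (\row_s psi (r s)) *m invmx X.
have wX : w *m X = \row_s psi (r s) by rewrite mulmxKV.
have psiE : {in unit, forall x, psi x = \sum_i w 0 i * chi i x}.
  apply: (eq_odd n_gt2 n_odd) => [x|x|s]; first exact: odd_characterN.
    by rewrite -sumrN; apply: eq_bigr => i _; rewrite odd_characterN // mulrN.
  move/rowP/(_ s): wX; rewrite !mxE => <-; apply: eq_bigr => i _.
  by rewrite !mxE.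
have w0 g i : g \in unit -> w 0 i * (chi i g - psi g) = 0.
  move=> gu.
  have : (\row_i (w 0 i * (chi i g - psi g))) *m X = 0.
    apply/rowP => s; rewrite !mxE.
    have := psiE (g * r s); rewrite unitrM gu (half_rep_unit n_gt2) // => /(_ isT).
    have [[_ psiM _] _] := psiP.
    rewrite psiM (psiE (r s)) ?(half_rep_unit n_gt2) // mulr_sumr => /eqP.
    rewrite -subr_eq0 -sumrB => /eqP/(congr1 -%R); rewrite oppr0 -sumrN => sum0.
    rewrite -[RHS]sum0.
    apply: eq_bigr => j _; rewrite !mxE; have [[_ chiM _] _] := chiP j.
    by rewrite chiM; ring.
  move/(congr1 (mulmx^~ (invmx X))); rewrite mulmxK // mul0mx => /rowP/(_ i).
  by rewrite !mxE.
have [i wi] : exists i, w 0 i != 0.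
  apply/existsP; apply: contraT; rewrite negb_exists => /forallP allw.
  have := psiE 1 (unitr1 _); have [[-> _ _] _] := psiP.
  rewrite big1 => [/eqP|i _]; first by rewrite oner_eq0.
  by move: (allw i); rewrite negbK => /eqP ->; rewrite mul0r.
exists i => //; apply/ffunP => x; have [xu|xu] := boolP (x \in unit).
  by have /eqP := w0 x i xu; rewrite mulf_eq0 (negbTE wi) subr_eq0 => /eqP.
by rewrite !character_nonunit //; [case: psiP | case: (chiP i)].
Qed.

(** Left multiplication by the basis of characters evaluates the operator of
    kernel [f (j k)] on each [chi]: substituting [j = x k^-1] gives
    [chi (k^-1)] times the eigenvalue. The factor [2^-1] passes from
    representatives to all units. *)
Lemma det_odd_mul (f : 'Z_n -> F) (chi : 'I_h -> {ffun 'Z_n -> F}) :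
  (forall x, f (- x) = - f x) ->
  (forall i, odd_characters R n (chi i)) ->
  (\matrix_(i, s) chi i (r s)) \in unitmx ->
  \det (\matrix_(s, t) f (r s * r t)) =
  \det (inversion_mx n) * \prod_i (2^-1 * \sum_(x in unit) chi i x * f x).
Proof.
move=> fN chiP Xu; set X := \matrix_(i, s) _ in Xu.
set M := \matrix_(s, t) _.
suff XM : X *m M =
   diag_mx (\row_i (2^-1 * \sum_(x in unit) chi i x * f x)) *m (X *m inversion_mx n).
  apply: (@mulfI _ (\det X)); first by rewrite -unitfE -unitmxE.
  rewrite -det_mulmx XM !det_mulmx det_diag mulrC mulrA; congr (_ * _).
by apply: eq_bigr => i _; rewrite mxE.
apply/matrixP => i t; rewrite mul_diag_mx !mxE.
have [[_ chiM _] _] := chiP i; have tu := half_rep_unit n_gt2 t.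
have -> : \sum_j X i j * inversion_mx n j t = chi i (r t)^-1.
  rewrite -(@odd_expansion _ _ n_gt2 n_odd (chi i)) ?unitrV //; last first.
    by move=> x; exact: odd_characterN.
  by apply: eq_bigr => s _; rewrite !mxE.
apply: (@mulIf _ 2); first by rewrite pnatr_eq0.
rewrite mulr_natr (eq_bigr (fun s => chi i (r s) * f (r s * r t))); last first.
  by move=> s _; rewrite !mxE.
rewrite -(@sum_units_even n n_gt2 n_odd _ (fun x => chi i x * f (x * r t))); last first.
  by move=> x; rewrite mulNr fN odd_characterN // mulrNN.
have tVu : (r t)^-1 \is a GRing.unit by rewrite unitrV.
have twice (a b : F) : 2^-1 * a * b * 2 = a * b by field.
rewrite (reindex_inj (mulIr tVu)) /= twice mulr_suml.
apply: eq_big => [x|x _]; first by rewrite unitrM tVu andbT.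
by rewrite divrK // chiM mulrAC.
Qed.

End OddCharacters.

(** * Square roots of 1 and of -1 modulo n *)

Section SquareRoots.
Local Open Scope nat_scope.

Definition num_sqrt (d c : nat) : nat := #|[set x : 'I_d | x * x == c %[mod d]]%SET|.

Lemma card_sqrt_classes d c : 1 < d -> #|sqrt_classes (c%:R : 'Z_d)%R| = num_sqrt d c.
Proof.
case: d => [|[|d]] // _; apply: eq_card => x; rewrite !inE.
by rewrite -val_eqE /= val_Zp_nat.
Qed.

Lemma num_sqrt_mod d c c' : c = c' %[mod d] -> num_sqrt d c = num_sqrt d c'.
Proof. by move=> cc; apply: eq_card => x; rewrite !inE cc. Qed.

Lemma num_sqrt_coprime d1 d2 c : 0 < d1 -> 0 < d2 -> coprime d1 d2 ->
  num_sqrt (d1 * d2) c = num_sqrt d1 c * num_sqrt d2 c.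
Proof.
move=> d1_gt0 d2_gt0 co; rewrite /num_sqrt -cardsX.
pose f (x : 'I_(d1 * d2)) : 'I_d1 * 'I_d2 :=
  (Ordinal (ltn_pmod x d1_gt0), Ordinal (ltn_pmod x d2_gt0)).
have f_inj : injective f.
  move=> x y [e1 e2]; apply: val_inj.
  have /eqP : x = y %[mod d1 * d2] by apply/eqP; rewrite chinese_remainder // e1 e2 !eqxx.
  by rewrite !modn_small // => /eqP.
rewrite -(card_imset _ f_inj); apply: eq_card => -[a b].
rewrite !inE /=; apply/imsetP/andP => [[x]|[aS bS]].
  by rewrite inE chinese_remainder // => /andP[x1 x2] [-> ->] /=; rewrite !modnMm.
have xlt : chinese d1 d2 a b %% (d1 * d2) < d1 * d2 by rewrite ltn_pmod // muln_gt0 d1_gt0.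
have xa : chinese d1 d2 a b %% (d1 * d2) %% d1 = a.
  by rewrite modn_dvdm ?dvdn_mulr // chinese_modl // modn_small.
have xb : chinese d1 d2 a b %% (d1 * d2) %% d2 = b.
  by rewrite modn_dvdm ?dvdn_mull // chinese_modr // modn_small.
exists (Ordinal xlt); last by congr pair; apply: val_inj.
rewrite inE chinese_remainder //= -[_ * _ %% d1]modnMm -[_ * _ %% d2]modnMm xa xb.
by rewrite aS bS.
Qed.

(** Modulo a power of an odd prime [p], two square roots [x] and [y] of a unit
    satisfy [(x - y) (x + y) = 0], and [p] cannot divide both factors. *)
Lemma num_sqrt_prime_power p e c : prime p -> odd p -> 0 < e -> coprime p c ->
  num_sqrt (p ^ e) c = 0 \/ num_sqrt (p ^ e) c = 2.
Proof.
move=> pp podd e0 pc; have pe1 : 1 < p ^ e by rewrite -(exp1n e) ltn_exp2r // prime_gt1.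
have unitE (x : 'Z_(p ^ e)) : (x \is a GRing.unit) = ~~ (p %| x).
  by rewrite -{1}[x]natr_Zp unitZpE // coprime_pexpl // prime_coprime.
rewrite -card_sqrt_classes //.
have [->|[y]] := set_0Vmem (sqrt_classes (c%:R : 'Z_(p ^ e))%R).
  by left; rewrite cards0.
rewrite inE => /eqP yy; right.
have cu : (c%:R : 'Z_(p ^ e))%R \is a GRing.unit by rewrite unitZpE // coprime_pexpl.
have yu : y \is a GRing.unit by move: cu; rewrite -yy unitrM => /andP[].
have nonunitD (u v : 'Z_(p ^ e)) : p %| u -> p %| v -> p %| (u + v)%R.
  move=> pu pv; have -> : (u + v)%R = (u + v)%N%:R%R by rewrite natrD !natr_Zp.
  rewrite val_Zp_nat // /dvdn modn_dvdm //; first by rewrite -/(dvdn p _) dvdn_add.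
  by rewrite -{1}[p]expn1 dvdn_exp2l.
have two : (2%:R : 'Z_(p ^ e))%R \is a GRing.unit.
  by rewrite unitZpE // coprime_pexpl // coprimen2.
have yNy : y != (- y)%R.
  rewrite -GRing.subr_eq0 opprK -mulr2n -mulr_natl; apply: contraTneq yu => y2.
  have yu2 : ((2%:R * y)%R : 'Z_(p ^ e)) \is a GRing.unit = (y \is a GRing.unit).
    by rewrite unitrM two.
  by rewrite -yu2 y2 unitE dvdn0.
have -> : sqrt_classes (c%:R : 'Z_(p ^ e))%R = [set y; (- y)%R]%SET.
  apply/finset.setP => x; rewrite !inE; apply/eqP/orP; last first.
    by case=> /eqP ->; rewrite ?mulrNN.
  move=> xx; have xy0 : ((x - y) * (x + y) = 0)%R.
    by rewrite mulrDr !mulrBl xx yy [(x * y)%R]mulrC; ring.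
  have [p2|p2] := boolP (p %| (x + y)%R); last first.
    left; rewrite -subr_eq0; apply/eqP; rewrite -unitE in p2.
    by apply: (mulIr p2); rewrite mul0r.
  have [p1|p1] := boolP (p %| (x - y)%R); last first.
    right; rewrite -addr_eq0; apply/eqP; rewrite -unitE in p1.
    by apply: (mulrI p1); rewrite mulr0.
  have := nonunitD _ _ p2 p1; have -> : (x + y + (x - y) = 2%:R * x)%R by ring.
  have : (2%:R * x)%R \is a GRing.unit.
    by rewrite unitrM two /=; move: cu; rewrite -xx unitrM => /andP[].
  by rewrite unitE => /negbTE ->.
by rewrite cards2 yNy.
Qed.

Lemma num_sqrt1_prime_power p e : prime p -> odd p -> 0 < e -> num_sqrt (p ^ e) 1 = 2.
Proof.
move=> pp podd e0; have pe1 : 1 < p ^ e by rewrite -(exp1n e) ltn_exp2r // prime_gt1.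
case: (num_sqrt_prime_power pp podd e0 (coprimen1 p)) => // /eqP.
by rewrite cards_eq0 => /eqP/finset.setP/(_ (Ordinal pe1)); rewrite !inE /= eqxx.
Qed.

(** The inversion is taken over the algebraic numbers, and only the counting part
    of [det_inversion_mx] is kept. *)
Lemma totient_sqrt_mod4 d : 2 < d -> odd d -> exists m,
  totient d + num_sqrt d d.-1 = num_sqrt d 1 + 4 * m.
Proof.
move=> d2 dodd; have d1 := ltnW d2.
have [m [E _]] := @det_inversion_mx algC d d2 dodd.
have dE : (d.-1%:R : 'Z_d)%R = (- 1)%R.
  by rewrite -subn1 natrB ?(ltnW d1) // pchar_Zp // GRing.sub0r.
by exists m; rewrite -!card_sqrt_classes // dE.
Qed.

Lemma totient_prime_power_mod4 p e : prime p -> odd p -> 0 < e ->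
  totient (p ^ e) %% 4 = if p %% 4 == 1 then 0 else 2.
Proof.
move=> pp podd e0; rewrite totient_pfactor //.
have kodd : odd (p ^ e.-1) by rewrite oddX podd orbT.
have p0 := prime_gt0 pp; rewrite -modnMm.
have [k1|k3] : p ^ e.-1 %% 4 = 1 \/ p ^ e.-1 %% 4 = 3 by lia.
  rewrite k1; have [p4|p4] : p %% 4 = 1 \/ p %% 4 = 3 by lia.
    by rewrite p4; have -> : p.-1 %% 4 = 0 by lia.
  by rewrite p4; have -> : p.-1 %% 4 = 2 by lia.
rewrite k3; have [p4|p4] : p %% 4 = 1 \/ p %% 4 = 3 by lia.
  by rewrite p4; have -> : p.-1 %% 4 = 0 by lia.
by rewrite p4; have -> : p.-1 %% 4 = 2 by lia.
Qed.

(** Whether [-1] is a square is decided modulo [4] by [totient_sqrt_mod4] applied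
    to the prime power itself. *)
Lemma num_sqrtN1_prime_power p e c : prime p -> odd p -> 0 < e -> p ^ e %| c.+1 ->
  num_sqrt (p ^ e) c = if p %% 4 == 1 then 2 else 0.
Proof.
move=> pp podd e0 pec.
have p2 : 2 < p by rewrite odd_prime_gt2.
have pe2 : 2 < p ^ e by rewrite (leq_trans p2) // -{1}[p]expn1 leq_pexp2l // prime_gt0.
have co : coprime p c.
  apply: (coprime_dvdl (dvdn_trans _ pec)); rewrite ?coprimeSn //.
  by rewrite -{1}[p]expn1 dvdn_exp2l.
have -> : num_sqrt (p ^ e) c = num_sqrt (p ^ e) (p ^ e).-1.
  apply: num_sqrt_mod; case/dvdnP: pec => q cq.
  have -> : c = q.-1 * p ^ e + (p ^ e).-1.
    by move: (p ^ e) cq pe2 => d; case: q => [|q] /=; lia.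
  by rewrite modnMDl.
have co' : coprime p (p ^ e).-1.
  by rewrite -(@coprime_pexpl e) // coprime_sym coprimePn // ltnW // ltnW.
have [m] := totient_sqrt_mod4 pe2 (etrans (oddX _ _) (introT orP (or_intror podd))).
have := totient_prime_power_mod4 pp podd e0; rewrite num_sqrt1_prime_power //.
by case: (num_sqrt_prime_power pp podd e0 co') => ->; case: eqP => // _; lia.
Qed.

Lemma primes_consP n p s : 0 < n -> primes n = p :: s ->
  exists m, [/\ n = p ^ logn p n * m, coprime (p ^ logn p n) m, prime p,
    (0 < logn p n) && (0 < m) & primes m = s].
Proof.
move=> n0 ns.
have pn : p \in primes n by rewrite ns mem_head.
exists (n`_p^')%N; split.
- by rewrite -p_part partnC.
- by rewrite -p_part coprime_partC.
- by move: pn; rewrite mem_primes => /andP[].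
- by rewrite logn_gt0 pn part_gt0.
rewrite primes_part ns /= inE /= !inE eqxx /=.
have := sorted_primes n; rewrite ns => /(sorted_uniq ltn_trans ltnn) /= /andP[ps _].
by apply/all_filterP/allP => q qs; rewrite !inE; apply: contraNneq ps => <-.
Qed.

Lemma odd_square_mod8 p : odd p -> p * p %% 8 = 1.
Proof.
move=> podd; rewrite -modnMm.
have : p %% 8 = 1 \/ p %% 8 = 3 \/ p %% 8 = 5 \/ p %% 8 = 7 by lia.
by case=> [->|[->|[->|->]]].
Qed.

Lemma odd_expn_mod8 p e : odd p -> p ^ e %% 8 = if odd e then p %% 8 else 1.
Proof.
move=> podd; rewrite -[in LHS](odd_double_half e) expnD -mul2n expnM -mulnn -modnMm.
rewrite -[(p * p) ^ _ %% 8]modnXm odd_square_mod8 // exp1n.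
by case: odd; rewrite ?expn1 ?expn0 //= muln1 modn_mod.
Qed.

(** Since [4 m] is a combination of [totient n] and of numbers of square roots,
    its class modulo [8] is enough. With three prime divisors or more all of
    these are divisible by [8]; with one or two, the class follows from the
    residues of the primes. *)
Lemma sign_epsE n m : 2 < n -> odd n ->
  totient n + num_sqrt n n.-1 = num_sqrt n 1 + 4 * m -> sign_eps n = ((- 1) ^+ m)%R.
Proof.
move=> n2 nodd.
have n0 : 0 < n by apply: leq_trans n2.
have nE : n.-1.+1 = n by rewrite prednK.
have podd p : p \in primes n -> odd p.
  by rewrite mem_primes => /and3P[_ _ pn]; exact: dvdn_odd pn nodd.
rewrite /sign_eps -(signr_odd _ m).
case ns : (primes n) => [|p s].
  by move/eqP: ns; rewrite primes_eq0; lia.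
have [n1 [E1 co1 pp /andP[e0 n10] ns1]] := primes_consP n0 ns.
have po : odd p by rewrite podd // ns inE eqxx.
set e := logn p n in E1 co1 e0 *.
have pe0 : 0 < p ^ e by rewrite expn_gt0 prime_gt0.
have t1 := totient_prime_power_mod4 pp po e0.
have c1 : num_sqrt (p ^ e) n.-1 = if p %% 4 == 1 then 2 else 0.
  by apply: num_sqrtN1_prime_power; rewrite // nE E1 dvdn_mulr.
have a1 := num_sqrt1_prime_power pp po e0.
case: s ns1 ns => [|q s] ns1 ns.
  have n11 : n1 = 1 by move/eqP: ns1; rewrite primes_eq0; lia.
  have nE' : n = p ^ e by rewrite E1 n11 muln1.
  have tE : totient n = p.-1 * p ^ e.-1 by rewrite nE' totient_pfactor.
  have t8 : totient n %% 8 = (p.-1 %% 8) * (if odd e then 1 else p %% 8) %% 8.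
    rewrite tE -modnMm (odd_expn_mod8 _ po).
    by have -> : odd e.-1 = ~~ odd e; [lia | case: odd].
  have -> : num_sqrt n n.-1 = if p %% 4 == 1 then 2 else 0 by rewrite {1}nE'.
  have -> : num_sqrt n 1 = 2 by rewrite nE'.
  set b := _ || _.
  have -> : (if b then (-1) ^+ (totient n)./2 else (-1) ^+ (totient n)./2.+1)%R
      = ((-1) ^+ odd ((totient n)./2 + ~~ b))%R :> int.
    by rewrite signr_odd; case: b; rewrite ?addn0 ?addn1.
  move=> Em; congr ((-1) ^+ _)%R; congr nat_of_bool.
  have bE : b = (p %% 8 == 1) || (p %% 8 == if odd e then 7 else 3).
    by rewrite /b; congr (_ || _); apply/eqP/eqP; case: ifP; lia.
  rewrite bE {b bE} in Em *; clear - t8 Em po.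
  have p8 : p %% 8 = 1 \/ p %% 8 = 3 \/ p %% 8 = 5 \/ p %% 8 = 7 by lia.
  have p1 : p.-1 %% 8 = (p %% 8).-1 by lia.
  have p4 : p %% 4 = p %% 8 %% 4 by lia.
  rewrite p1 in t8; rewrite p4 in Em.
  by case: p8 t8 Em => [->|[->|[->|->]]]; case: (odd e) => /=; lia.
have qo : odd q by rewrite podd // ns !inE eqxx orbT.
have [n3 [E2 co2 qp /andP[f0 n20] ns2]] := primes_consP n10 ns1.
set f := logn q n1 in E2 co2 f0 *.
have qf0 : 0 < q ^ f by rewrite expn_gt0 prime_gt0.
have t2 := totient_prime_power_mod4 qp qo f0.
have c2 : num_sqrt (q ^ f) n.-1 = if q %% 4 == 1 then 2 else 0.
  by apply: num_sqrtN1_prime_power; rewrite // nE E1 E2 mulnA dvdn_mulr // dvdn_mull.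
have a2 := num_sqrt1_prime_power qp qo f0.
have tE : totient n = totient (p ^ e) * (totient (q ^ f) * totient n3).
  by rewrite E1 totient_coprime // {1}E2 totient_coprime.
have sE c : num_sqrt n c = num_sqrt (p ^ e) c * (num_sqrt (q ^ f) c * num_sqrt n3 c).
  by rewrite E1 num_sqrt_coprime // {1}E2 num_sqrt_coprime.
rewrite tE !sE c1 c2 a1 a2.
move: (totient (p ^ e)) (totient (q ^ f)) t1 t2 => x y x4 y4.
case: s ns1 ns ns2 => [|l s] ns1 ns ns2.
  have -> : n3 = 1 by move/eqP: ns2; rewrite primes_eq0; lia.
  have sqrt_mod1 c : num_sqrt 1 c = 1.
    by rewrite -[RHS](card_ord 1); apply: eq_card => k; rewrite !inE !modn1.
  have -> : totient 1 = 1 by [].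
  rewrite !sqrt_mod1 !muln1.
  have xy8 : x * y %% 8 = if (p %% 4 == 1) || (q %% 4 == 1) then 0 else 4.
    rewrite (divn_eq x 4) (divn_eq y 4) x4 y4.
    move: (x %/ 4) (y %/ 4) => u v.
    have -> a b : (u * 4 + a) * (v * 4 + b) = 16 * (u * v) + 4 * (u * b + v * a) + a * b.
      by ring.
    by move: (u * v) => w; clear; case: (p %% 4 == 1); case: (q %% 4 == 1) => /=; lia.
  move=> Em.
  have -> : (4 %| p + q) = (p %% 4 == 1) (+) (q %% 4 == 1).
    have odd4 k : odd k -> k %% 4 = 1 \/ k %% 4 = 3 by lia.
    by rewrite /dvdn -modnDm; case: (odd4 p po) (odd4 q qo) => -> [] ->.
  set b := _ (+) _; have -> : (if b then (-1) ^+ (x * y)./2.+1 else (-1) ^+ (x * y)./2)%R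
      = ((-1) ^+ odd ((x * y)./2 + b))%R :> int.
    by rewrite signr_odd; case: b; rewrite ?addn0 ?addn1.
  congr ((-1) ^+ _)%R; congr nat_of_bool; rewrite /b; move: xy8 Em; move: (x * y) => t.
  by clear; case: (p %% 4 == 1); case: (q %% 4 == 1) => /=; lia.
have lo : odd l by rewrite podd // ns !inE eqxx !orbT.
have [n4 [E3 co3 lp /andP[g0 n40] ns3]] := primes_consP n20 ns2.
set g := logn l n3 in E3 co3 g0 *.
have lg0 : 0 < l ^ g by rewrite expn_gt0 prime_gt0.
have t3 := totient_prime_power_mod4 lp lo g0.
have c3 : num_sqrt (l ^ g) n.-1 = if l %% 4 == 1 then 2 else 0.
  apply: num_sqrtN1_prime_power; rewrite // nE E1 E2 E3.
  by rewrite dvdn_mull // dvdn_mull // dvdn_mulr.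
have a3 := num_sqrt1_prime_power lp lo g0.
rewrite E3 totient_coprime // !num_sqrt_coprime // c3 a3.
move: (totient (l ^ g)) t3 => z z4 Em.
have ev w d : w %% 4 = (if d then 0 else 2) -> exists k, w = 2 * k.
  by move=> wd; exists (w %/ 2); case: d wd; lia.
have [x' xE] := ev _ _ x4; have [y' yE] := ev _ _ y4; have [z' zE] := ev _ _ z4.
move: Em; rewrite xE yE zE.
have -> w : 2 * x' * (2 * y' * (2 * z' * w)) = 8 * (x' * y' * z' * w) by ring.
have -> w : 2 * (2 * (2 * w)) = 8 * w by ring.
have two (d : bool) : (if d then 2 else 0) = 2 * d by case: d.
rewrite !two.
have -> u v k w : 2 * u * (2 * v * (2 * k * w)) = 8 * (u * v * k * w) by ring.
move=> Em; set t := (X in 8 * X) in Em *.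
have -> : (8 * t)./2 = (2 * t).*2 by lia.
by rewrite -signr_odd odd_double; congr ((-1) ^+ _)%R; congr nat_of_bool; lia.
Qed.

End SquareRoots.

(** * The value of L(1, chi) for odd chi *)

Section OddLValue.
Context {R : realType}.
Variable n : nat.
Hypotheses (n_gt2 : (2 < n)%N) (n_odd : odd n).
Local Notation unit := (GRing.unit : {pred 'Z_n}).

Let n_gt1 : (1 < n)%N. Proof. exact: ltnW. Qed.

(** The cotangent at [x pi / n] depends only on the class of [x], by
    [pi]-periodicity. *)
Definition cot_class (x : 'Z_n) : R := cot ((x : nat)%:R * pi / n%:R).

Lemma cot_classE m : cot_class m%:R = cot (m%:R * pi / n%:R).
Proof.
rewrite /cot_class val_Zp_nat // {2}(divn_eq m n).
elim: (m %/ n)%N => [|q IH] //; rewrite IH -[LHS]cotDpi mulSn -addnA natrD.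
congr cot; field; rewrite ?pnatr_eq0; lia.
Qed.

Lemma cot_classN x : cot_class (- x) = - cot_class x.
Proof.
have xn : (x < n)%N by have := ltn_ord x; rewrite {2}Zp_cast.
have -> : - x = (n - x)%:R by rewrite natrB ?(ltnW xn) // (natr_Zp x) pchar_Zp // sub0r.
rewrite cot_classE /cot_class -cotN -[RHS]cotDpi natrB ?(ltnW xn) //.
congr cot; field; rewrite ?pnatr_eq0; lia.
Qed.

(** Division by zero being zero, this holds even where the functions have
    poles. *)
Lemma csc_double (y : R) : csc (y *+ 2) = cot y - cot (y *+ 2).
Proof.
rewrite /csc /cot sin_mulr2n cos_mulr2n.
have [s0|s0] := eqVneq (sin y) 0; first by rewrite s0 !(mulr0, mul0rn, invr0, subr0).
have [c0|c0] := eqVneq (cos y) 0; first by rewrite c0 !(mul0r, mul0rn, invr0, mulr0, subr0).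
have -> : cos y ^+ 2 *+ 2 - 1 = cos y ^+ 2 - sin y ^+ 2.
  by have := cos2Dsin2 y; lra.
rewrite -[LHS]mul1r -(cos2Dsin2 y); field; by rewrite s0 c0.
Qed.

Lemma cpowN1 k : cpow k.+1 (-1) = k.+1%:R^-1 :> R[i].
Proof.
rewrite /cpow /cexp mulN1r /= oppr0 cos0 sin0 complexr0 mulr1.
by rewrite expRN lnK ?posrE ?ltr0n // fmorphV rmorph_nat.
Qed.

Lemma sum_Zp_nat (V : nmodType) (G : 'Z_n -> V) : \sum_(0 <= a < n) G a%:R = \sum_x G x.
Proof.
case: n n_gt1 G => [|[|k]] // _ G; rewrite big_mkord.
by apply: eq_bigr => x _; rewrite natr_Zp.
Qed.

Lemma dirichlet_L1 (chi : {ffun 'Z_n -> R[i]}) : odd_characters R n chi ->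
  dirichlet_L 1 chi = pi%:C / (2 * n%:R) * \sum_(x in unit) chi x * (cot_class x)%:C.
Proof.
move=> chiP; have [chiD _] := chiP.
pose f m : R[i] := chi m%:R.
have f0 : f 0%N = 0 by rewrite /f character_nonunit // unitr0.
have fper m : f (m + n)%N = f m by rewrite /f natrD pchar_Zp // addr0.
have fodd a : (0 < a < n)%N -> f (n - a)%N = - f a.
  by move=> /andP[_ an]; rewrite /f natrB ?(ltnW an) // pchar_Zp // sub0r odd_characterN.
have n0 : (0 < n)%N by exact: ltnW.
have cv := cvg_odd_periodic_series n0 fper f0 fodd.
rewrite /dirichlet_L.
have -> : (fun k : nat => chi k.+1%:R * cpow k.+1 (- 1) : (R[i] : numFieldType)) =
    (fun k => f k.+1 * k.+1%:R^-1).
  by apply/funext => k; rewrite cpowN1.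
rewrite (cvg_lim _ cv); last exact: norm_hausdorff.
congr (_ * _).
have -> : \sum_(x in unit) chi x * (cot_class x)%:C = \sum_x chi x * (cot_class x)%:C.
  rewrite [LHS]big_mkcond; apply: eq_bigr => x _; case: ifPn => // xu.
  by rewrite character_nonunit // mul0r.
rewrite -sum_Zp_nat [RHS]big_ltn // -/(f 0%N) f0 mul0r add0r.
by apply: eq_bigr => a _; rewrite cot_classE.
Qed.

Lemma two_unit : (2 : 'Z_n) \is a GRing.unit.
Proof. by rewrite unitZpE // coprimen2. Qed.

(** The summand is [csc (2 pi x / n)] by [csc_double], and replacing [2 x] by
    [x] in its second half costs a factor [chi(2)^-1]. *)
Lemma odd_character_csc_sum (chi : {ffun 'Z_n -> R[i]}) : odd_characters R n chi ->
  2^-1 * \sum_(x in unit) chi x * (cot_class x - cot_class (2 * x))%:C =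
  n%:R / pi%:C * ((1 - (chi 2)^-1) * dirichlet_L 1 chi).
Proof.
move=> chiP; rewrite dirichlet_L1 //; have [[_ chiM chiu] _] := chiP.
set T := \sum_(x in unit) chi x * (cot_class x)%:C.
have chi2 : chi 2 != 0 by rewrite chiu two_unit.
have -> : \sum_(x in unit) chi x * (cot_class x - cot_class (2 * x))%:C =
   T - (chi 2)^-1 * T.
  have -> : (chi 2)^-1 * T = \sum_(x in unit) chi x * (cot_class (2 * x))%:C.
    rewrite /T (reindex_inj (mulrI two_unit)) /= mulr_sumr.
    apply: eq_big => [x|x _]; first by rewrite unitrM two_unit.
    by rewrite chiM -mulrA mulKf.
  by rewrite -sumrB; apply: eq_bigr => x _; rewrite rmorphB /= mulrBr.
have pi0 : pi%:C != 0 :> R[i].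
  by rewrite (inj_eq (@complexI R) pi 0) gt_eqF // pi_gt0.
have nC0 : n%:R != 0 :> R[i] by rewrite pnatr_eq0 -lt0n ltnW.
move: pi%:C (chi 2) T n%:R pi0 chi2 nC0 => p c t k p0 c0 k0.
by field; rewrite p0 c0 k0.
Qed.

(** Inversion permutes the odd characters, so [1 - chi(2)^-1] may be replaced
    by [1 - chi(2)] in a product over all of them. *)
Lemma prod_odd_characters_inv (G : R[i] -> R[i]) :
  \big[*%R/1]_(chi \in odd_characters R n) G (chi 2)^-1 =
  \big[*%R/1]_(chi \in odd_characters R n) G (chi 2).
Proof.
pose inv_char (chi : {ffun 'Z_n -> R[i]}) := [ffun x => (chi x)^-1].
have invK chi : inv_char (inv_char chi) = chi.
  by apply/ffunP => x; rewrite !ffunE invrK.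
have invP chi : odd_characters R n chi -> odd_characters R n (inv_char chi).
  move=> [[c1 cM cu] cN]; split; last by rewrite ffunE cN invrN1.
  split; first by rewrite ffunE c1 invr1.
  - by move=> a b; rewrite !ffunE cM invfM.
  - by move=> a; rewrite ffunE invr_eq0 cu.
rewrite (reindex_fsbig inv_char (odd_characters R n)) /=.
  by apply: eq_fsbigr => chi _; rewrite ffunE invrK.
split=> [chi|chi psi _ _ e|chi chiP]; first exact: invP.
  by rewrite -(invK chi) e invK.
by exists (inv_char chi); [exact: invP | exact: invK].
Qed.

End OddLValue.

Unset Implicit Arguments.

Theorem theorem1p9 (R : realType) (n : nat) (n_ge3 : (3 <= n)%N)
    (n_odd : odd n) :
  (\det (cscmx R n))%:C =
  (sign_eps n)%:~R * ((n%:R / pi) ^+ (totient n)./2)%:C *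
  \big[*%R/1]_(chi \in odd_characters R n) ((1 - chi 2%:R) * dirichlet_L 1 chi).
Proof.
have [chi [chiP Xu]] := @odd_characters_basis R n n_ge3 n_odd.
have bij := odd_characters_complete n_ge3 n_odd chiP Xu.
have prodE (G : {ffun 'Z_n -> R[i]} -> R[i]) :
    \big[*%R/1]_(psi \in odd_characters R n) G psi = \prod_i G (chi i).
  rewrite (reindex_fsbig chi [set` enum 'I_#|half_units n|]%classic); last first.
    suff -> : [set` enum 'I_#|half_units n|]%classic =
      [set: 'I_#|half_units n|]%classic by [].
    by apply/seteqP; split=> // i _ /=; rewrite mem_enum.
  by rewrite -fsbig_seq ?enum_uniq // big_enum.
pose f (x : 'Z_n) : R[i] := (cot_class x - cot_class (2 * x) : R)%:C.
have fN x : f (- x) = - f x.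
  by rewrite /f mulrN !cot_classN // -rmorphN opprB opprK addrC.
have -> : (\det (cscmx R n))%:C = \det (\matrix_(s, t) f (half_rep s * half_rep t)).
  rewrite -det_map_mx; congr (\det _); apply/matrixP => s t; rewrite !mxE.
  rewrite /f /half_rep -natrM -natrM !cot_classE //=.
  have := csc_double ((enum_val s * enum_val t)%N%:R * pi / n%:R : R).
  have -> : ((enum_val s * enum_val t)%N%:R * pi / n%:R : R) *+ 2 =
      (2 * (enum_val s * enum_val t))%:R * pi / n%:R by rewrite natrM; ring.
  by move=> <-; rewrite mulnA.
have [m [cardE detE]] := @det_inversion_mx (R[i] : numClosedFieldType) n n_ge3 n_odd.
rewrite (det_odd_mul n_ge3 n_odd fN chiP Xu) detE.
have -> : (sign_eps n)%:~R = (-1) ^+ m :> R[i].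
  rewrite (sign_epsE n_ge3 n_odd (m := m)).
    by rewrite rmorphXn /= rmorphN1.
  rewrite -!card_sqrt_classes ?(ltnW n_ge3) // -cardE; congr (_ + #|sqrt_classes _|)%N.
  by rewrite -subn1 natrB ?pchar_Zp ?sub0r // ltnW // ltnW.
rewrite -mulrA; congr (_ * _).
rewrite (eq_bigr _ (fun i _ => odd_character_csc_sum n_ge3 n_odd (chiP i))).
rewrite big_split /= prodr_const card_ord (card_half_units n_ge3 n_odd) muln2 doubleK.
rewrite rmorphXn /= fmorph_div rmorph_nat; congr (_ * _).
rewrite prodE !big_split /=; congr (_ * _).
rewrite -(prodE (fun psi => 1 - (psi 2)^-1)).
by rewrite (prod_odd_characters_inv n (fun z => 1 - z)) prodE.
Qed.
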